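(* Suppose that $$\sum_{j=1}^{\infty} p_{j}(j)<\infty \quad\text{a.s.}$$ and that the distribution of $Y(n)$ has a weak limit as $n\to\infty$, i.e. $\lim_{n\to\infty} f_{n}(t)=f(t)$ for all $t\in\mathbb{R}$, where $f$ is the characteristic function of the limiting distribution. Then there exists the limit $$\lim_{n\to \infty} \varphi_{n}(t) =\varphi_\infty (t):= f(t)\prod_{j=1}^{\infty }\bigl[ 1+(f_{j}(t)-1)p_{j}(j)\bigr] \quad \text{a.s.}$$
   Context: Random recursive tree in random environment. Let $w(0)=1$ and let $w(1),w(2),\dots>0$ be (generally random) weights. Let $Y(1),Y(2),\dots\ge 0$ be independent random variables, the sequence $\{Y(j)\}_{j\ge1}$ being independent of $\{w(j)\}_{j\ge0}$. The tree starts from the root $v(0)$. At step $n\ge1$ a vertex $v(n)$ is attached as a child of $v(n^* )$, where, given the weights (and independently of the edge lengths and of all earlier choices), the index $n^*\in\{0,\dots,n-1\}$ takes the value $i$ with probability $w(i)/\sum_{q=0}^{n-1}w(q)$ (so $1^*=0$); the new edge has length $Y(n)$. The distance from $v(n)$ to the root is $D_n$, where $D_0:=0$ and $D_n:=D_{n^*}+Y(n)$, $n\ge1$. Notation: $W_n:=\sum_{j=0}^n w(j)$, $p_n(j):=w(j)/W_n$ for $0\le j\le n$; $f_j(t):=\mathbf{E}\,e^{itY(j)}$ for $j\ge1$; $\varphi_n(t):=\mathbf{E}[e^{itD_n}\mid w(1),\dots,w(n-1)]$ for $n\ge1$. *)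

(* Defs.v *)
From HB Require Import structures.
From mathcomp Require Import all_boot all_order all_algebra finmap.
From mathcomp Require Export complex.
From mathcomp Require Import all_classical all_reals all_analysis.

Set Implicit Arguments.
Unset Strict Implicit.
Unset Printing Implicit Defensive.

Import Order.TTheory GRing.Theory Num.Theory numFieldNormedType.Exports.
Local Open Scope classical_set_scope.
Local Open Scope ring_scope.
Local Open Scope complex_scope.

Section Defs.
Context d (T : measurableType d) (R : realType) (P : probability T R).

Definition expi (s : R) : R[i] := cos s +i* sin s.

Definition cexpectation (Z : T -> R[i]) : R[i] :=
  fine 'E_P[fun x => complex.Re (Z x)] +i* fine 'E_P[fun x => complex.Im (Z x)].

Definition charfun (X : T -> R) (t : R) : R[i] :=
  cexpectation (fun x => expi (t * X x)).

(* The system of events {X i \in B} for i \in I and B measurable; the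
   sigma-algebra sigma(X i, i \in I) is <<s rv_events I X >>, which is
   {set0, setT} when I is empty. *)
Definition rv_events d' (T' : measurableType d') (I : set nat)
    (X : nat -> {RV P >-> T'}) : set (set T) :=
  \bigcup_(i in I) preimage_set_system setT (X i) measurable.

Definition mutually_independent (I : set nat) (X : nat -> {RV P >-> R}) : Prop :=
  forall (J : {fset nat}) (B : nat -> set R),
    [set` J] `<=` I -> (forall j, measurable (B j)) ->
    P (\bigcap_(j in [set` J]) (X j @^-1` B j)) =
    (\prod_(j <- J) P (X j @^-1` B j))%E.

Definition independent_systems (G H : set (set T)) : Prop :=
  forall A B, G A -> H B -> P (A `&` B) = (P A * P B)%E.

(* Z is a version of the conditional expectation E[X | G], where G is a
   sub-sigma-algebra. *)
Definition is_cond_exp (G : set (set T)) (X Z : T -> R) : Prop :=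
  [/\ P.-integrable setT (EFin \o Z),
      forall B : set R, measurable B -> G (Z @^-1` B) &
      forall A, G A ->
        (\int[P]_(x in A) (Z x)%:E = \int[P]_(x in A) (X x)%:E)%E].

Definition is_ccond_exp (G : set (set T)) (X Z : T -> R[i]) : Prop :=
  is_cond_exp G (fun x => complex.Re (X x)) (fun x => complex.Re (Z x)) /\
  is_cond_exp G (fun x => complex.Im (X x)) (fun x => complex.Im (Z x)).

Definition total_weight (w : nat -> {RV P >-> R}) (n : nat) (x : T) : R :=
  \sum_(0 <= j < n.+1) w j x.

Definition wprob (w : nat -> {RV P >-> R}) (n j : nat) (x : T) : R :=
  w j x / total_weight w n x.

(* Everything on which the choice of n^* is conditioned: all the weights, all
   the edge lengths and the earlier choices k^*, 1 <= k < n. *)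
Definition attachment_past (w Y : nat -> {RV P >-> R})
    (nstar : nat -> {RV P >-> nat}) (n : nat) : set (set T) :=
  <<s rv_events setT w `|` rv_events [set j | (1 <= j)%N] Y
      `|` rv_events [set k | (1 <= k < n)%N] nstar >>.

(* P(n^* = i | past) = p_{n-1}(i) for 0 <= i <= n-1. *)
Definition attachment_law (w Y : nat -> {RV P >-> R})
    (nstar : nat -> {RV P >-> nat}) : Prop :=
  forall n i : nat, (1 <= n)%N -> (i < n)%N ->
    is_cond_exp (attachment_past w Y nstar n)
      \1_(nstar n @^-1` [set i]) (wprob w n.-1 i).

End Defs.

(* Main.v *)
Require Import Defs.
From HB Require Import structures.
From mathcomp Require Import all_boot all_order all_algebra finmap.
From mathcomp Require Import complex.
From mathcomp Require Import all_classical all_reals all_analysis.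
From mathcomp Require Import ring lra.

Set Implicit Arguments.
Unset Strict Implicit.
Unset Printing Implicit Defensive.

Import Order.TTheory GRing.Theory Num.Theory numFieldNormedType.Exports.
Import measurable_realfun.
Local Open Scope classical_set_scope.
Local Open Scope ring_scope.
Local Open Scope complex_scope.

(** The conditional characteristic function has a closed form. Write f_j for the
    characteristic function of Y(j) at a fixed t. Given the weights, the depth of
    v(n) is that of a random older vertex, of law p_{n-1}, plus an independent
    edge length, so that the conditional characteristic functions satisfy
      phi_n = f_n * sum_{i < n} p_{n-1}(i) phi_i.
    Let S_n = sum_{i <= n} p_n(i) phi_i. Adding the vertex n to the mixture keeps a
    fraction 1 - p_n(n) of S_{n-1} and adds p_n(n) f_n S_{n-1}; hence
    S_n = S_{n-1} (1 + (f_n - 1) p_n(n)) ([sum_wprob_cond_charfun]), and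
      phi_n = f_n * prod_{1 <= j < n} (1 + (f_j - 1) p_j(j))  almost surely.

    That this expression is a version of the conditional expectation is
    [cond_charfun_is_ccond_exp]. It rests on [cexpectation_depth], an induction
    over the vertices which also carries a bounded function of the weights and a
    product over later edges, and on the extension of the hypotheses (conditional
    law of n*, independence) from events to bounded functions
    ([cexpectation_mul_eq]). Versions of a conditional expectation being almost
    surely equal ([is_ccond_exp_ae_unique]), the formula holds almost surely for
    all n at once.

    It remains to pass to the limit in a deterministic product. As |f_j| <= 1, each
    factor is a convex combination of 1 and f_j, so the partial products stay in
    the unit disc and move by at most 2 p_j(j) at step j; they converge when the
    p_j(j) are summable ([is_cvg_convex_prod]). *)

(** * Bounded functions measurable for a generated sigma-algebra *)

Section BoundedMeasurable.
Context d (T : measurableType d) (R : realType).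
Implicit Types (F : set (set T)) (h : T -> R) (Z : T -> R[i]).

(** Sub-sigma-algebras are handled through a generating system F, as in the
    definition of conditional expectations: the measurable sets are <<s F >>. *)
Definition gmeasurable d' (T' : measurableType d') F (X : T -> T') :=
  measurable_fun [set: g_sigma_algebraType F] (X : g_sigma_algebraType F -> T').

Definition bmeas F h := gmeasurable F h /\ exists M, forall x, `|h x| <= M.

(** Bounded measurable functions form an algebra inside the integrable functions,
    which frees every computation below from integrability conditions. *)
Definition cbmeas F Z :=
  bmeas F (fun x => complex.Re (Z x)) /\ bmeas F (fun x => complex.Im (Z x)).

Lemma gmeasurable_sub d' (T' : measurableType d') F F' (X : T -> T') :
  F `<=` <<s F' >> -> gmeasurable F X -> gmeasurable F' X.
Proof.
move=> FF' mX _ B mB.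
apply: (smallest_sub _ FF' (mX measurableT B mB)).
exact: smallest_sigma_algebra.
Qed.

Lemma sigma_generated_measurable F A :
  F `<=` measurable -> <<s F >> A -> measurable A.
Proof.
move=> Fm FA; apply: (smallest_sub _ Fm FA); exact: sigma_algebra_measurable.
Qed.

Lemma gmeasurable_full F h : F `<=` measurable -> gmeasurable F h ->
  measurable_fun setT h.
Proof.
by move=> Fm mh _ B mB; apply: sigma_generated_measurable Fm (mh measurableT B mB).
Qed.

Lemma bmeas_sub F F' h : F `<=` <<s F' >> -> bmeas F h -> bmeas F' h.
Proof. by move=> FF' [mh bh]; split => //; exact: gmeasurable_sub mh. Qed.

Lemma bmeas_cst F r : bmeas F (fun=> r).
Proof. by split; [exact: measurable_cst|exists `|r|]. Qed.

Lemma bmeasD F h1 h2 : bmeas F h1 -> bmeas F h2 ->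
  bmeas F (fun x => h1 x + h2 x).
Proof.
move=> [m1 [M1 b1]] [m2 [M2 b2]]; split; first exact: measurable_funD.
by exists (M1 + M2) => x; rewrite (le_trans (ler_normD _ _)) ?lerD.
Qed.

Lemma bmeasM F h1 h2 : bmeas F h1 -> bmeas F h2 ->
  bmeas F (fun x => h1 x * h2 x).
Proof.
move=> [m1 [M1 b1]] [m2 [M2 b2]]; split; first exact: measurable_funM.
by exists (M1 * M2) => x; rewrite normrM ler_pM.
Qed.

Lemma bmeasN F h : bmeas F h -> bmeas F (fun x => - h x).
Proof.
move=> mh; under eq_fun do rewrite -mulN1r.
by apply: bmeasM => //; exact: bmeas_cst.
Qed.

Lemma bmeasB F h1 h2 : bmeas F h1 -> bmeas F h2 ->
  bmeas F (fun x => h1 x - h2 x).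
Proof. by move=> m1 m2; apply: bmeasD => //; exact: bmeasN. Qed.

Lemma bmeas_indic F A : <<s F >> A -> bmeas F (\1_A).
Proof.
move=> mA; split => /=.
  exact: (@measurable_realfun.measurable_indic _ (g_sigma_algebraType F)).
by exists 1 => x; rewrite indicE; case: (_ \in _); rewrite ?normr1 ?normr0.
Qed.

Lemma cbmeas_sub F F' Z : F `<=` <<s F' >> -> cbmeas F Z -> cbmeas F' Z.
Proof. by move=> FF' [m1 m2]; split; apply: bmeas_sub FF' _. Qed.

Lemma bmeas_full F h : F `<=` measurable -> bmeas F h -> bmeas measurable h.
Proof.
by move=> Fm; apply: bmeas_sub => A /Fm mA; exact: sub_sigma_algebra.
Qed.

Lemma cbmeas_full F Z : F `<=` measurable -> cbmeas F Z -> cbmeas measurable Z.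
Proof. by move=> Fm [m1 m2]; split; exact: bmeas_full Fm _. Qed.

Lemma cbmeas_cst F c : cbmeas F (fun=> c).
Proof. by split; exact: bmeas_cst. Qed.

Lemma cbmeas_real F h : bmeas F h -> cbmeas F (fun x => (h x)%:C).
Proof. by move=> mh; split => //; exact: bmeas_cst. Qed.

Lemma complexReD (a b : R[i]) : complex.Re (a + b) = complex.Re a + complex.Re b.
Proof. by case: a; case: b. Qed.

Lemma complexImD (a b : R[i]) : complex.Im (a + b) = complex.Im a + complex.Im b.
Proof. by case: a; case: b. Qed.

Lemma cbmeasD F Z1 Z2 : cbmeas F Z1 -> cbmeas F Z2 ->
  cbmeas F (fun x => Z1 x + Z2 x).
Proof.
move=> [r1 i1] [r2 i2]; split => /=.
- by under eq_fun do rewrite complexReD; exact: bmeasD.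
- by under eq_fun do rewrite complexImD; exact: bmeasD.
Qed.

Lemma complexReM (a b : R[i]) : complex.Re (a * b) =
  complex.Re a * complex.Re b - complex.Im a * complex.Im b.
Proof. by case: a; case: b. Qed.

Lemma complexImM (a b : R[i]) : complex.Im (a * b) =
  complex.Re a * complex.Im b + complex.Im a * complex.Re b.
Proof. by case: a; case: b. Qed.

Lemma cbmeasM F Z1 Z2 : cbmeas F Z1 -> cbmeas F Z2 ->
  cbmeas F (fun x => Z1 x * Z2 x).
Proof.
move=> [r1 i1] [r2 i2]; split => /=.
- by under eq_fun do rewrite complexReM; apply: bmeasB; exact: bmeasM.
- by under eq_fun do rewrite complexImM; apply: bmeasD; exact: bmeasM.
Qed.

Lemma cbmeas_sum F I (s : seq I) (p : pred I) (Z : I -> T -> R[i]) :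
  (forall i, p i -> cbmeas F (Z i)) ->
  cbmeas F (fun x => \sum_(i <- s | p i) Z i x).
Proof.
move=> mZ; elim: s => [|i s IH].
  by under eq_fun do rewrite big_nil; exact: cbmeas_cst.
under eq_fun do rewrite big_cons.
by case: (boolP (p i)) => // pi; apply: cbmeasD => //; exact: mZ.
Qed.

Lemma cbmeas_prod F I (s : seq I) (p : pred I) (Z : I -> T -> R[i]) :
  (forall i, p i -> cbmeas F (Z i)) ->
  cbmeas F (fun x => \prod_(i <- s | p i) Z i x).
Proof.
move=> mZ; elim: s => [|i s IH].
  by under eq_fun do rewrite big_nil; exact: cbmeas_cst.
under eq_fun do rewrite big_cons.
by case: (boolP (p i)) => // pi; apply: cbmeasM => //; exact: mZ.
Qed.

Lemma cbmeas_indic F A : <<s F >> A -> cbmeas F (fun x => (\1_A x : R)%:C).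
Proof. by move=> FA; apply: cbmeas_real; exact: bmeas_indic. Qed.

Lemma cbmeas_expi F t (X : T -> R) : gmeasurable F X ->
  cbmeas F (fun x => expi (t * X x)).
Proof.
move=> mX; have mtX : gmeasurable F (fun x => t * X x) by exact: measurable_funM.
split; (split; last by exists 1 => x; rewrite /= ?cos_max ?sin_max).
- apply: measurableT_comp mtX; apply: continuous_measurable_fun.
  exact: continuous_cos.
- apply: measurableT_comp mtX; apply: continuous_measurable_fun.
  exact: continuous_sin.
Qed.

End BoundedMeasurable.

(** * Vanishing and uniqueness of integrals over a sub-sigma-algebra *)

Section Expectation.
Context d (T : measurableType d) (R : realType) (P : probability T R).
Implicit Types (F : set (set T)) (h U H K : T -> R) (Z : T -> R[i]).

Lemma bmeas_integrable h A : measurable A -> bmeas measurable h ->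
  P.-integrable A (EFin \o h).
Proof.
move=> mA [mh [M bh]]; apply: measurable_bounded_integrable => //.
- by rewrite (le_lt_trans (probability_le1 _ _)) ?ltry.
- exact: measurable_funTS (gmeasurable_full _ mh).
- exists M; split; first exact: num_real.
  by move=> N MN x _; exact: le_trans (bh x) (ltW MN).
Qed.

Lemma Rintegral_indic_mul A h :
  \int[P]_(x in A) h x = \int[P]_x (\1_A x * h x).
Proof.
rewrite Rintegral_mkcond; apply: eq_Rintegral => x _.
by rewrite patchE indicE; case: (_ \in _); rewrite ?mul1r ?mul0r.
Qed.

(** The class of [0, 1]-valued F-measurable functions is stable under
    K |-> 2 K - 1_{K >= 1/2}, and this map doubles the integral against U
    because the indicator contributes nothing. Iterating it n times multiplies
    the integral by 2^n, whereas all these integrals are at most a bound of U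
    in absolute value: they vanish. *)
Lemma Rintegral_unit_mul_eq0 F U H : F `<=` measurable ->
    bmeas measurable U -> (forall A, <<s F >> A -> \int[P]_(x in A) U x = 0) ->
    gmeasurable F H -> (forall x, 0 <= H x <= 1) ->
  \int[P]_x (H x * U x) = 0.
Proof.
move=> Fm mU U0 mH H01.
have [M bU] := mU.2.
have M0 : 0 <= M by rewrite (le_trans _ (bU point)).
have bmF K : gmeasurable F K -> (forall x, 0 <= K x <= 1) -> bmeas F K.
  move=> mK K01; split => //; exists 1 => x.
  by have /andP[K0 K1] := K01 x; rewrite ger0_norm.
have intF K : bmeas F K -> P.-integrable setT (EFin \o (fun x => K x * U x)).
  move=> mK; apply: bmeas_integrable => //; apply: bmeasM => //.
  exact: bmeas_full Fm mK.
have halving n : forall K, gmeasurable F K -> (forall x, 0 <= K x <= 1) ->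
    `|\int[P]_x (K x * U x)| * 2 ^+ n <= M.
  elim: n => [|n IH] K mK K01; have bK := bmF _ mK K01.
    rewrite expr0 mulr1 (le_trans (le_normr_Rintegral _ _))//;
      first exact: intF.
    rewrite -[leRHS]mulr1 -[X in M * X]/(fine 1%E) -(@probability_setT _ _ _ P).
    rewrite -Rintegral_cst//; apply: le_Rintegral => //.
    - by apply: integrable_norm; exact: intF.
    - exact: finite_measure_integrable_cst.
    - move=> x _; have /andP[K0 K1] := K01 x.
      by rewrite normrM (ger0_norm K0) -[leRHS]mul1r ler_pM.
  pose A := [set x | 2^-1 <= K x].
  have mA : <<s F >> A.
    have := mK measurableT _ (measurable_itv `[2^-1, +oo[).
    by rewrite setTI; congr (<<s F >> _); apply/seteqP; split => x;
      rewrite /A/= in_itv/= andbT.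
  pose K' x := 2 * K x - \1_A x.
  have bA : bmeas F (\1_A : T -> R) by exact: bmeas_indic.
  have bK' : bmeas F K' by apply: bmeasB => //; apply: bmeasM => //;
    exact: bmeas_cst.
  have K'01 x : 0 <= K' x <= 1.
    have := K01 x; rewrite /K' indicE; case: (boolP (x \in A)) => [|/negP];
      rewrite inE /A/= => xA ?; lra.
  have -> : \int[P]_x (K x * U x) = 2^-1 * \int[P]_x (K' x * U x).
    have -> : \int[P]_x (K x * U x) =
        2^-1 * (\int[P]_x (\1_A x * U x) + \int[P]_x (K' x * U x)).
      rewrite -RintegralD//; [|exact: intF..].
      rewrite -RintegralZl//; last first.
        under [X in _.-integrable _ (_ \o X)]eq_fun do rewrite -mulrDl.
        by apply: intF; exact: bmeasD.
      by apply: eq_Rintegral => x _; rewrite /K'; field.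
    by rewrite -Rintegral_indic_mul U0// add0r.
  rewrite normrM gtr0_norm ?invr_gt0// exprS mulrACA mulVf ?pnatr_eq0// mul1r.
  exact: IH bK'.1 K'01.
apply/eqP; rewrite -normr_eq0 eq_le normr_ge0 andbT.
apply/ler_addgt0Pl => e e0; rewrite addr0.
have := halving (Num.bound (M / e)) _ mH H01.
have Mb : M < e * 2 ^+ Num.bound (M / e).
  rewrite -ltr_pdivrMl// mulrC.
  have Me : 0 <= M / e by rewrite divr_ge0 // ltW.
  apply: (lt_trans (archi_boundP Me)).
  by rewrite -natrX ltr_nat ltn_expl.
by move=> /le_lt_trans/(_ Mb); rewrite ltr_pM2r ?exprn_gt0// => /ltW.
Qed.

(** An affine change of variable brings a bounded function into [0, 1]. *)
Lemma Rintegral_mul_eq0 F U H : F `<=` measurable ->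
    bmeas measurable U -> (forall A, <<s F >> A -> \int[P]_(x in A) U x = 0) ->
    bmeas F H -> \int[P]_x (H x * U x) = 0.
Proof.
move=> Fm mU U0 mH.
have [M bH] := mH.2.
pose N := `|M| + 1.
have N0 : 0 < N by rewrite /N ltr_wpDl.
pose K x := (2 * N)^-1 * (H x + N).
have mK : bmeas F K.
  by apply: bmeasM; [exact: bmeas_cst|apply: bmeasD => //; exact: bmeas_cst].
have K01 x : 0 <= K x <= 1.
  have := le_trans (bH x) (ler_norm M); rewrite ler_norml => /andP[h1 h2].
  have N2 : 0 < 2 * N by rewrite mulr_gt0.
  rewrite /K mulrC divr_ge0 ?(ltW N2) ?ler_pdivrMr ?mul1r//=;
    move: h1 h2; rewrite /N; lra.
have := Rintegral_unit_mul_eq0 Fm mU U0 mK.1 K01.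
have := U0 setT (@measurableT _ (g_sigma_algebraType F)).
have intU : P.-integrable setT (EFin \o U) by exact: bmeas_integrable.
have intHU : P.-integrable setT (EFin \o (fun x => H x * U x)).
  by apply: bmeas_integrable => //; apply: bmeasM => //; exact: bmeas_full Fm _.
move=> U00 KU0.
have : \int[P]_x (H x * U x + N * U x) = 0.
  transitivity (2 * N * \int[P]_x (K x * U x)); last by rewrite KU0 mulr0.
  rewrite -RintegralZl//; last first.
    apply: bmeas_integrable => //; apply: bmeasM => //.
    exact: bmeas_full Fm _.
  by apply: eq_Rintegral => x _; rewrite /K; field; rewrite gt_eqF.
rewrite RintegralD//; last first.
  apply: bmeas_integrable => //; apply: bmeasM => //.
  exact: bmeas_cst.
by rewrite RintegralZl// U00 mulr0 addr0.
Qed.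

End Expectation.

Section Uniqueness.
Context d (T : measurableType d) (R : realType) (P : probability T R).
Implicit Types (F : set (set T)) (h U H K : T -> R).

(** The sets {U >= 0} and {U <= 0} are themselves in the sigma-algebra, and on
    each of them the integral of |U| is, up to sign, the integral of U. *)
Lemma Rintegral_set_eq0_ae F U : F `<=` measurable -> gmeasurable F U ->
    P.-integrable setT (EFin \o U) ->
    (forall A, <<s F >> A -> \int[P]_(x in A) U x = 0) ->
  {ae P, forall x, U x = 0}.
Proof.
move=> Fm mU iU U0.
have gm A := @sigma_generated_measurable _ _ F A Fm.
have ge0_ae V : gmeasurable F V -> P.-integrable setT (EFin \o V) ->
    (forall A, <<s F >> A -> \int[P]_(x in A) V x = 0) ->
    {ae P, forall x, 0 <= V x -> V x = 0}.
  move=> mV iV V0; pose A := [set x | 0 <= V x].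
  have FA : <<s F >> A.
    have := mV measurableT _ (measurable_itv `[0, +oo[).
    by rewrite setTI; congr (<<s F >> _); apply/seteqP; split => x;
      rewrite /A/= in_itv/= andbT.
  have mA := gm _ FA.
  have iA : P.-integrable A (EFin \o V) by exact: integrableS iV.
  have := @ae_eq_integral_abs _ _ _ P A mA (EFin \o V).
  case=> [|+ _]; first by case/integrableP: iA.
  have -> : (\int[P]_(x in A) `|(EFin \o V) x| = 0)%E.
    rewrite (eq_integral (EFin \o V)); last first.
      by move=> x; rewrite inE /A /= => Vx; rewrite ger0_norm.
    by rewrite -[LHS]fineK ?integrable_fin_num// -[fine _]/(Rintegral _ _ _) V0.
  move=> /(_ erefl); apply: filterS => x /= + Vx => /(_ Vx).
  by case.
have a1 := ge0_ae _ mU iU U0.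
have /ge0_ae a2 : gmeasurable F (fun x => - U x) by exact: measurableT_comp.
have {}a2 : {ae P, forall x, 0 <= - U x -> - U x = 0}.
  apply: a2 => [|A FA].
    by under [X in _.-integrable _ X]eq_fun do rewrite /= EFinN; exact: integrableN.
  transitivity (\int[P]_(x in A) (-1 * U x)).
    by apply: eq_Rintegral => x _; rewrite mulN1r.
  by rewrite RintegralZl ?U0 ?mulr0//; [exact: gm|exact: integrableS (gm _ FA) _ iU].
apply: filterS2 a1 a2 => x p n.
have [/p//|/ltW] := leP 0 (U x).
by rewrite -oppr_ge0 => /n /eqP; rewrite oppr_eq0 => /eqP.
Qed.

Lemma is_cond_exp_ae_unique F X Z1 Z2 : F `<=` measurable ->
    is_cond_exp P <<s F >> X Z1 -> is_cond_exp P <<s F >> X Z2 ->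
  {ae P, forall x, Z1 x = Z2 x}.
Proof.
move=> Fm [i1 m1 e1] [i2 m2 e2].
have gm A := @sigma_generated_measurable _ _ F A Fm.
have : {ae P, forall x, Z1 x - Z2 x = 0}.
  apply: (@Rintegral_set_eq0_ae F) => //.
  - by apply: measurable_funB => _ B mB; rewrite setTI; [exact: m1|exact: m2].
  - by under [X in _.-integrable _ X]eq_fun do rewrite /= EFinB; exact: integrableB.
  - move=> A FA; rewrite RintegralB; first last.
    + exact: integrableS (gm _ FA) _ i2.
    + exact: integrableS (gm _ FA) _ i1.
    + exact: gm.
    + by rewrite /Rintegral e1// e2// subrr.
by apply: filterS => x /eqP; rewrite subr_eq0 => /eqP.
Qed.

End Uniqueness.

(** * Expectations of bounded complex random variables *)

Section ComplexExpectation.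
Context d (T : measurableType d) (R : realType) (P : probability T R).
Implicit Types (F : set (set T)) (Z : T -> R[i]) (c : R[i]).

Lemma cexpectationE Z : cexpectation P Z =
  (\int[P]_x complex.Re (Z x)) +i* (\int[P]_x complex.Im (Z x)).
Proof. by rewrite /cexpectation unlock. Qed.

Lemma cexpectationD Z1 Z2 : cbmeas measurable Z1 -> cbmeas measurable Z2 ->
  cexpectation P (fun x => Z1 x + Z2 x) = cexpectation P Z1 + cexpectation P Z2.
Proof.
move=> [r1 i1] [r2 i2]; rewrite !cexpectationE.
under eq_Rintegral do rewrite complexReD.
under [X in _ +i* X]eq_Rintegral do rewrite complexImD.
by rewrite !RintegralD//; exact: bmeas_integrable.
Qed.

Lemma cexpectationZ c Z : cbmeas measurable Z ->
  cexpectation P (fun x => c * Z x) = c * cexpectation P Z.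
Proof.
move=> [rZ iZ]; have i1 := bmeas_integrable P measurableT rZ.
have i2 := bmeas_integrable P measurableT iZ.
have iM r h : bmeas measurable h ->
    P.-integrable setT (EFin \o (fun x => r * h x)).
  by move=> mh; apply: bmeas_integrable => //; apply: bmeasM => //; exact: bmeas_cst.
rewrite !cexpectationE.
under eq_Rintegral do rewrite complexReM.
under [X in _ +i* X]eq_Rintegral do rewrite complexImM.
rewrite RintegralB ?RintegralD//; [|exact: iM..].
by rewrite !RintegralZl//; case: c.
Qed.

Lemma cexpectationZr c Z : cbmeas measurable Z ->
  cexpectation P (fun x => Z x * c) = cexpectation P Z * c.
Proof.
by move=> mZ; rewrite mulrC -cexpectationZ//; under eq_fun do rewrite mulrC.
Qed.

Lemma cexpectation_cst c : cexpectation P (fun=> c) = c.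
Proof.
by rewrite cexpectationE !Rintegral_cst//= !probability_setT !mulr1; case: c.
Qed.

Lemma cexpectation_sum I (s : seq I) (Z : I -> T -> R[i]) :
  (forall i, cbmeas measurable (Z i)) ->
  cexpectation P (fun x => \sum_(i <- s) Z i x) =
  \sum_(i <- s) cexpectation P (Z i).
Proof.
move=> mZ; elim: s => [|i s IH].
  by under eq_fun do rewrite big_nil; rewrite big_nil cexpectation_cst.
under eq_fun do rewrite big_cons.
rewrite cexpectationD ?IH ?big_cons//.
exact: cbmeas_sum.
Qed.

(** The defining property of a conditional expectation extends from indicators
    to all bounded F-measurable multipliers. The statement serves both for
    conditional laws and for independence, where Z2 is constant. The real and
    imaginary parts of W and Z1 - Z2 reduce it to four real integrals. *)
Lemma cexpectation_mul_eq F Z1 Z2 W : F `<=` measurable ->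
    cbmeas measurable Z1 -> cbmeas measurable Z2 ->
    (forall A, <<s F >> A -> cexpectation P (fun x => (\1_A x)%:C * Z1 x) =
                             cexpectation P (fun x => (\1_A x)%:C * Z2 x)) ->
    cbmeas F W ->
  cexpectation P (fun x => W x * Z1 x) = cexpectation P (fun x => W x * Z2 x).
Proof.
move=> Fm [r1 i1] [r2 i2] eqA [rW iW].
pose U1 x := complex.Re (Z1 x) - complex.Re (Z2 x).
pose U2 x := complex.Im (Z1 x) - complex.Im (Z2 x).
have mU1 : bmeas measurable U1 by exact: bmeasB.
have mU2 : bmeas measurable U2 by exact: bmeasB.
have int h : bmeas measurable h -> P.-integrable setT (EFin \o h).
  by exact: bmeas_integrable.
have FGb h : bmeas F h -> bmeas measurable h by exact: bmeas_full.
have indG A : <<s F >> A -> bmeas measurable (\1_A : T -> R).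
  by move=> FA; apply: FGb; exact: bmeas_indic.
have U10 A : <<s F >> A -> \int[P]_(x in A) U1 x = 0.
  move=> FA; have [+ _] := eqA _ FA; rewrite !unlock => e.
  rewrite Rintegral_indic_mul; under eq_Rintegral do rewrite /U1 mulrBr.
  rewrite RintegralB//; [|by apply: int; apply: bmeasM => //; exact: indG..].
  apply/eqP; rewrite subr_eq0; apply/eqP; move: e.
  under eq_integral do rewrite complexReM/= mul0r subr0.
  by under [in RHS]eq_integral do rewrite complexReM/= mul0r subr0.
have U20 A : <<s F >> A -> \int[P]_(x in A) U2 x = 0.
  move=> FA; have [_ +] := eqA _ FA; rewrite !unlock => e.
  rewrite Rintegral_indic_mul; under eq_Rintegral do rewrite /U2 mulrBr.
  rewrite RintegralB//; [|by apply: int; apply: bmeasM => //; exact: indG..].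
  apply/eqP; rewrite subr_eq0; apply/eqP; move: e.
  under eq_integral do rewrite complexImM/= mul0r addr0.
  by under [in RHS]eq_integral do rewrite complexImM/= mul0r addr0.
have U0 h U : bmeas F h -> bmeas measurable U ->
    (forall A, <<s F >> A -> \int[P]_(x in A) U x = 0) ->
    \int[P]_x (h x * U x) = 0.
  by move=> mh mU /(Rintegral_mul_eq0 Fm mU); exact.
apply/eqP; rewrite -subr_eq0; apply/eqP.
transitivity (cexpectation P (fun x => W x * Z1 x + (-1) * (W x * Z2 x))).
  have mW : cbmeas measurable W by split; exact: FGb.
  have mWZ1 : cbmeas measurable (fun x => W x * Z1 x) by exact: cbmeasM.
  have mWZ2 : cbmeas measurable (fun x => W x * Z2 x) by exact: cbmeasM.
  rewrite cexpectationD//; last by apply: cbmeasM => //; exact: cbmeas_cst.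
  by rewrite cexpectationZ// mulN1r.
rewrite cexpectationE.
have mM h U : bmeas F h -> bmeas measurable U ->
    P.-integrable setT (EFin \o (fun x => h x * U x)).
  by move=> mh mU; apply: int; apply: bmeasM => //; exact: FGb.
congr (_ +i* _).
- transitivity (\int[P]_x (complex.Re (W x) * U1 x - complex.Im (W x) * U2 x)).
    by apply: eq_Rintegral => x _; rewrite -mulrN1 /U1 /U2;
      case: (W x) (Z1 x) (Z2 x) => [? ?] [? ?] [? ?]/=; ring.
  by rewrite RintegralB ?U0 ?subrr//; exact: mM.
- transitivity (\int[P]_x (complex.Re (W x) * U2 x + complex.Im (W x) * U1 x)).
    by apply: eq_Rintegral => x _; rewrite /U1 /U2;
      case: (W x) (Z1 x) (Z2 x) => [? ?] [? ?] [? ?]/=; ring.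
  by rewrite RintegralD ?U0 ?addr0//; exact: mM.
Qed.

End ComplexExpectation.

(** * Products of independent random variables *)

Section Independence.
Context d (T : measurableType d) (R : realType) (P : probability T R).
Implicit Types (F : set (set T)) (Z : T -> R[i]) (X : nat -> {RV P >-> R}).

Lemma cexpectation_indic A : measurable A ->
  cexpectation P (fun x => (\1_A x)%:C) = (fine (P A))%:C.
Proof.
move=> mA; rewrite cexpectationE /= Rintegral_cst//= mul0r.
by rewrite /Rintegral integral_indic// setIT.
Qed.

(** Replace Z2 by its expectation against F1-measurable factors; for an indicator
    of A in <<s F1 >> this holds because, symmetrically, that indicator may be
    replaced by P A against F2-measurable factors. *)
Lemma cexpectation_mul_indep F1 F2 Z1 Z2 :
    F1 `<=` measurable -> F2 `<=` measurable ->
    independent_systems P <<s F1 >> <<s F2 >> -> cbmeas F1 Z1 -> cbmeas F2 Z2 ->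
  cexpectation P (fun x => Z1 x * Z2 x) = cexpectation P Z1 * cexpectation P Z2.
Proof.
move=> F1m F2m indep m1 m2.
have full F A : F `<=` measurable -> <<s F >> A -> <<s measurable >> A.
  move=> Fm FA; apply: sub_sigma_algebra; exact: sigma_generated_measurable Fm FA.
transitivity (cexpectation P (fun x => Z1 x * cexpectation P Z2)); last first.
  by rewrite cexpectationZr//; exact: cbmeas_full F1m _.
apply: (cexpectation_mul_eq F1m) m1 => [||A FA].
- exact: cbmeas_full F2m _.
- exact: cbmeas_cst.
have mA := sigma_generated_measurable F1m FA.
have iA : cbmeas measurable (fun x => (\1_A x : R)%:C).
  by apply: cbmeas_indic; exact: full FA.
transitivity (cexpectation P (fun x => Z2 x * (fine (P A))%:C)).
  under eq_fun do rewrite mulrC.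
  apply: (cexpectation_mul_eq F2m) m2 => // [|B FB]; first exact: cbmeas_cst.
  have mB := sigma_generated_measurable F2m FB.
  transitivity (cexpectation P (fun x => (\1_(A `&` B) x)%:C)).
    by congr cexpectation; apply/funext => x; rewrite indicI mulrC -rmorphM.
  rewrite cexpectation_indic; last exact: measurableI.
  rewrite indep// fineM ?fin_num_measure// rmorphM/=.
  rewrite cexpectationZr; first by rewrite cexpectation_indic // mulrC.
  by apply: cbmeas_indic; exact: full FB.
rewrite cexpectationZr; last exact: cbmeas_full F2m _.
by rewrite cexpectationZr// cexpectation_indic// mulrC.
Qed.

Lemma preimage_system_measurable d' (T' : measurableType d') (Y : {RV P >-> T'}) :
  preimage_set_system setT Y measurable `<=` measurable.
Proof. by move=> _ [B mB <-]; exact: measurable_funP. Qed.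

(** Independence is assumed on events only. The indices of K carry indicators,
    those of J general functions: to treat one more j of J, it is enough to test
    against indicators of events of X j, that is, to move j from J to K, which
    the induction hypothesis allows since it holds for all K and B. *)
Lemma cexpectation_indic_prod_indep (I : set nat) X (Z : nat -> T -> R[i])
    (J K : seq nat) (B : nat -> set R) :
    mutually_independent I X ->
    (forall j, cbmeas (preimage_set_system setT (X j) measurable) (Z j)) ->
    (forall k, measurable (B k)) ->
    uniq (K ++ J) -> (forall j, j \in K ++ J -> I j) ->
  cexpectation P (fun x => (\prod_(k <- K) \1_(X k @^-1` B k) x)%:C *
                           \prod_(j <- J) Z j x) =
  (\prod_(k <- K) fine (P (X k @^-1` B k)))%:C *
  \prod_(j <- J) cexpectation P (Z j).
Proof.
move=> indep mZ;
  have full j :=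
  cbmeas_full (@preimage_system_measurable _ _ (X j)) (mZ j).
elim: J K B => [|j J IH] K B mB.
  rewrite cats0 => uK KI.
  under eq_fun do rewrite big_nil mulr1.
  rewrite big_nil mulr1.
  have -> : (fun x => (\prod_(k <- K) (\1_(X k @^-1` B k) x : R))%:C) =
      (fun x => (\1_(\bigcap_(k in [set` [fset k in K]%fset])
                       (X k @^-1` B k)) x : R)%:C).
    apply/funext => x; congr (_%:C); rewrite indicE.
    case: (boolP (x \in _)) => [|/negP]; rewrite inE => xB.
      rewrite big_seq big1// => k kK; rewrite indicE mem_set//.
      by apply: xB => /=; rewrite in_fset.
    have [k kK kB] : exists2 k, k \in K & ~ B k (X k x).
      apply: contra_notP xB => /forall2NP xB k /=; rewrite in_fset => kK.
      by have [//|/contrapT] := xB k.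
    by rewrite (big_rem k)//= indicE memNset// mul0r.
  rewrite cexpectation_indic; last first.
    by apply: fin_bigcap_measurable => // k _; exact: measurable_funPTI.
  rewrite indep//; last by move=> k /=; rewrite in_fset => /KI.
  congr (_%:C).
  have -> : (\prod_(k <- [fset k in K]%fset) P (X k @^-1` B k) =
             \prod_(k <- K) P (X k @^-1` B k))%E.
    apply: perm_big; apply: uniq_perm => // k; exact: in_fset.
  have finP k : P (X k @^-1` B k) \is a fin_num.
    by apply: fin_num_measure; exact: measurable_funPTI.
  elim: K {uK KI} => [|k K IHK]; rewrite ?big_nil// !big_cons fineM ?IHK//.
  by rewrite prode_fin_num.
move=> uKJ KJI.
have iZ (A : nat -> set T) (s : seq nat) : (forall k, measurable (A k)) ->
    cbmeas measurable (fun x => (\prod_(k <- s) (\1_(A k) x : R))%:C).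
  move=> mA; under eq_fun do rewrite rmorph_prod; apply: cbmeas_prod => k _.
  by apply: cbmeas_indic; exact: sub_sigma_algebra.
have mX k C : measurable C -> measurable (X k @^-1` C) by exact: measurable_funPTI.
set c := (X in _ = X).
pose c' := (\prod_(k <- K) fine (P (X k @^-1` B k)))%:C *
  \prod_(j <- J) cexpectation P (Z j).
transitivity (cexpectation P (fun x => Z j x *
   ((\prod_(k <- K) \1_(X k @^-1` B k) x)%:C * \prod_(j <- J) Z j x))).
  by congr cexpectation; apply/funext => x; rewrite big_cons mulrCA.
transitivity (cexpectation P (fun x => Z j x * c')); last first.
  by rewrite cexpectationZr// /c' /c big_cons mulrCA.
have mprod : cbmeas measurable (fun x =>
    (\prod_(k <- K) \1_(X k @^-1` B k) x)%:C * \prod_(j <- J) Z j x).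
  by apply: cbmeasM; [apply: iZ => k; exact: mX|exact: cbmeas_prod].
apply: (cexpectation_mul_eq (@preimage_system_measurable _ _ (X j))) (mZ j) => //.
  exact: cbmeas_cst.
move=> A; rewrite sigma_algebra_id; last first.
  apply: sigma_algebra_preimage; exact: sigma_algebra_measurable.
case=> C mC; rewrite setTI => <-{A}.
pose B' k := if k == j then C else B k.
have := IH (j :: K) B'.
have jKJ : j \notin K.
  by move: uKJ; rewrite cat_uniq => /and3P[_ /hasPn/(_ j)];
    rewrite mem_head => /(_ isT).
have B'K k : k \in K -> B' k = B k.
  by rewrite /B'; case: eqP => // -> jK; rewrite jK in jKJ.
rewrite big_cons [B' j]/B' eqxx => IHj.
transitivity (cexpectation P (fun x =>
   (\prod_(k <- j :: K) \1_(X k @^-1` B' k) x)%:C * \prod_(j <- J) Z j x)).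
  congr cexpectation; apply/funext => x; rewrite mulrA -rmorphM big_cons.
  rewrite [B' j]/B' eqxx; congr ((_ * _)%:C * _).
  by apply: eq_big_seq => k kK; rewrite B'K.
rewrite IHj; first last.
- by move=> k; rewrite inE mem_cat => kk; apply: KJI; rewrite mem_cat inE orbCA.
- by rewrite -(perm_uniq (_ : perm_eq (K ++ j :: J) _))// -cat1s perm_catCA.
- by move=> k; rewrite /B'; case: ifP.
rewrite cexpectationZr; last first.
  by apply: cbmeas_indic; apply: sub_sigma_algebra; exact: mX.
rewrite cexpectation_indic; last exact: mX.
rewrite rmorphM -mulrA /c'; congr (_ * (_%:C * _)).
by apply: eq_big_seq => k kK; rewrite B'K.
Qed.

Lemma cexpectation_prod_indep (I : set nat) X (Z : nat -> T -> R[i])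
    (J : seq nat) :
    mutually_independent I X ->
    (forall j, cbmeas (preimage_set_system setT (X j) measurable) (Z j)) ->
    uniq J -> (forall j, j \in J -> I j) ->
  cexpectation P (fun x => \prod_(j <- J) Z j x) =
  \prod_(j <- J) cexpectation P (Z j).
Proof.
move=> indep mZ uJ JI.
have := @cexpectation_indic_prod_indep I X Z J [::] (fun=> setT) indep mZ.
by under eq_fun do rewrite big_nil mul1r; rewrite big_nil mul1r; exact.
Qed.

End Independence.

(** * Complex conditional expectations *)

Section ConditionalExpectation.
Context d (T : measurableType d) (R : realType) (P : probability T R).
Implicit Types (F : set (set T)) (X Z : T -> R) (V H : T -> R[i]).

Lemma cexpectation_mul_cond_exp F X Z H : F `<=` measurable ->
    bmeas measurable X -> bmeas measurable Z -> is_cond_exp P <<s F >> X Z ->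
    cbmeas F H ->
  cexpectation P (fun x => H x * (X x)%:C) =
  cexpectation P (fun x => H x * (Z x)%:C).
Proof.
move=> Fm mX mZ [_ _ XZ]; apply: cexpectation_mul_eq => //.
- exact: cbmeas_real.
- exact: cbmeas_real.
move=> A FA; rewrite !cexpectationE/=.
under eq_Rintegral do rewrite mul0r subr0.
under [in RHS]eq_Rintegral do rewrite mul0r subr0.
congr (_ +i* _).
  by rewrite -!Rintegral_indic_mul /Rintegral XZ.
by apply: eq_Rintegral => x _; rewrite !mulr0 !mul0r.
Qed.

(** Converse of the previous lemma, in complex form: how a candidate version of a
    conditional expectation is recognized. *)
Lemma is_ccond_exp_cexpectation F V H : F `<=` measurable ->
    cbmeas measurable V -> cbmeas F H ->
    (forall A, <<s F >> A -> cexpectation P (fun x => (\1_A x)%:C * V x) =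
                             cexpectation P (fun x => (\1_A x)%:C * H x)) ->
  is_ccond_exp P <<s F >> V H.
Proof.
move=> Fm [rV iV] mH VH; have [rH iH] := cbmeas_full Fm mH.
have gm A := @sigma_generated_measurable _ _ F A Fm.
have meq X Z : bmeas measurable X -> bmeas F Z -> (forall A, <<s F >> A ->
    \int[P]_x (\1_A x * X x) = \int[P]_x (\1_A x * Z x)) ->
    is_cond_exp P <<s F >> X Z.
  move=> mX mZ eXZ; have mZ' := bmeas_full Fm mZ; split.
  - exact: bmeas_integrable.
  - by move=> B mB; have := mZ.1 measurableT _ mB; rewrite setTI.
  - move=> A FA; have mA := gm _ FA.
    have := congr1 (fun r : R => r%:E) (eXZ _ FA).
    rewrite -!Rintegral_indic_mul /Rintegral !fineK => [->//| |];
      by apply: integrable_fin_num => //; exact: bmeas_integrable.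
have RI A K :
    (\int[P]_x complex.Re ((\1_A x)%:C * K x) =
     \int[P]_x (\1_A x * complex.Re (K x))) *
    (\int[P]_x complex.Im ((\1_A x)%:C * K x) =
     \int[P]_x (\1_A x * complex.Im (K x))).
  by split; apply: eq_Rintegral => x _;
    rewrite (complexReM, complexImM)/= mul0r ?subr0 ?addr0.
have VHA A : <<s F >> A ->
    \int[P]_x (\1_A x * complex.Re (V x)) =
    \int[P]_x (\1_A x * complex.Re (H x)) /\
    \int[P]_x (\1_A x * complex.Im (V x)) =
    \int[P]_x (\1_A x * complex.Im (H x)).
  by move=> /VH; rewrite !cexpectationE !RI => -[].
split; apply: meq => //; [exact: mH.1| |exact: mH.2|] => A /VHA[]//.
Qed.

Lemma is_ccond_exp_ae_unique F V H1 H2 : F `<=` measurable ->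
    is_ccond_exp P <<s F >> V H1 -> is_ccond_exp P <<s F >> V H2 ->
  {ae P, forall x, H1 x = H2 x}.
Proof.
move=> Fm [r1 i1] [r2 i2].
have er := is_cond_exp_ae_unique Fm r1 r2.
have ei := is_cond_exp_ae_unique Fm i1 i2.
apply: filterS2 er ei => x; case: (H1 x) => a b; case: (H2 x) => a' b' /=.
by move=> -> ->.
Qed.

End ConditionalExpectation.

(** * The random recursive tree *)

Section Expi.
Variable R : realType.

Lemma expi0 : expi (0 : R) = 1.
Proof. by rewrite /expi cos0 sin0. Qed.

Lemma expiD (a b : R) : expi (a + b) = expi a * expi b.
Proof. by rewrite /expi cosD sinD; simpc; congr (_ +i* _); ring. Qed.

End Expi.

Section RandomVariableEvents.
Context d (T : measurableType d) (R : realType) (P : probability T R).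

Lemma rv_events_measurable d' (T' : measurableType d') I
    (X : nat -> {RV P >-> T'}) :
  rv_events I X `<=` measurable.
Proof. by move=> _ [i _ [B mB <-]]; exact: measurable_funP. Qed.

Lemma gmeasurable_rv d' (T' : measurableType d') F I
    (X : nat -> {RV P >-> T'}) i :
  I i -> rv_events I X `<=` F -> gmeasurable F (X i).
Proof.
move=> Ii IF _ B mB; apply: sub_sigma_algebra; apply: IF.
by exists i => //; exists B.
Qed.

End RandomVariableEvents.

Section Weights.
Context d (T : measurableType d) (R : realType) (P : probability T R).
Variable w : nat -> {RV P >-> R}.
Hypothesis w0 : forall x, w 0%N x = 1.
Hypothesis w_gt0 : forall j x, (1 <= j)%N -> 0 < w j x.

Lemma weight_gt0 j x : 0 < w j x.
Proof. by case: j => [|j]; [rewrite w0|exact: w_gt0]. Qed.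

Lemma total_weightS n x :
  total_weight w n.+1 x = total_weight w n x + w n.+1 x.
Proof. by rewrite /total_weight big_nat_recr. Qed.

Lemma total_weight_gt0 n x : 0 < total_weight w n x.
Proof.
elim: n => [|n IH]; first by rewrite /total_weight big_nat1 weight_gt0.
by rewrite total_weightS addr_gt0// weight_gt0.
Qed.

Lemma wprob_ge0 n j x : 0 <= wprob w n j x.
Proof. by rewrite divr_ge0// ltW ?weight_gt0 ?total_weight_gt0. Qed.

Lemma wprob_le1 n j x : (j <= n)%N -> wprob w n j x <= 1.
Proof.
move=> jn; rewrite /wprob ler_pdivrMr ?total_weight_gt0// mul1r /total_weight.
rewrite (bigD1_seq j) ?mem_index_iota ?iota_uniq//= lerDl sumr_ge0// => i _.
exact/ltW/weight_gt0.
Qed.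

Lemma wprob00 x : wprob w 0 0 x = 1.
Proof. by rewrite /wprob /total_weight big_nat1 divff// w0 oner_neq0. Qed.

(** The vertex n.+1 takes the fraction p_{n+1}(n+1) of the mass and leaves the
    proportions between the older vertices unchanged. *)
Lemma wprobS n j x :
  wprob w n.+1 j x = (1 - wprob w n.+1 n.+1 x) * wprob w n j x.
Proof.
have W0 := total_weight_gt0 n x; have W1 := total_weight_gt0 n.+1 x.
rewrite /wprob; rewrite total_weightS in W1 *.
by field; rewrite !gt_eqF.
Qed.

Lemma bmeas_wprob F n j : (forall k, (k <= n)%N -> gmeasurable F (w k)) ->
  (j <= n)%N -> bmeas F (wprob w n j).
Proof.
move=> mw jn; split; last first.
  by exists 1 => x; rewrite ger0_norm ?wprob_ge0// wprob_le1.
have mW k : (k <= n)%N -> gmeasurable F (total_weight w k).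
  elim: k => [|k IH] kn.
    rewrite (_ : total_weight w 0 = w 0%N); first exact: mw.
    by apply/funext => x; rewrite /total_weight big_nat1.
  rewrite (_ : total_weight w k.+1 = total_weight w k \+ w k.+1).
    by apply: measurable_funD; [exact: (IH (ltnW kn))|exact: mw].
  by apply/funext => x; rewrite total_weightS.
(* the reciprocal of a positive number as a power, a measurable function *)
rewrite (_ : wprob w n j = w j \* (fun x => total_weight w n x `^ (-1))).
  apply: measurable_funM; first exact: mw.
  by apply: (measurableT_comp (@measurable_powR R (-1))); exact: mW.
by apply/funext => x /=; rewrite powR_inv1// ltW// total_weight_gt0.
Qed.

End Weights.

Section Tree.
Context d (T : measurableType d) (R : realType) (P : probability T R).
Variables (w Y : nat -> {RV P >-> R}) (nstar : nat -> {RV P >-> nat}).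
Variables (D : nat -> T -> R) (t : R).
Hypothesis w0 : forall x, w 0%N x = 1.
Hypothesis w_gt0 : forall j x, (1 <= j)%N -> 0 < w j x.
Hypothesis Y_indep : mutually_independent [set j | (1 <= j)%N] Y.
Hypothesis Yw_indep : independent_systems P
  <<s rv_events [set j | (1 <= j)%N] Y >> <<s rv_events setT w >>.
Hypothesis nstar_lt : forall n x, (1 <= n)%N -> (nstar n x < n)%N.
Hypothesis nstar_law : attachment_law w Y nstar.
Hypothesis D0 : forall x, D 0%N x = 0.
Hypothesis DS : forall n x, (1 <= n)%N -> D n x = D (nstar n x) x + Y n x.

Let f j := charfun P (Y j) t.
Let p j x := wprob w j j x.

Definition charfun_prod n x : R[i] :=
  \prod_(1 <= j < n.+1) (1 + (f j - 1) * (p j x)%:C).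

(** The claimed value of E[exp(i t D_n) | w]: it depends on the weights of the
    vertices older than n only, and D_0 = 0 gives the value 1 at n = 0. *)
Definition cond_charfun n x : R[i] :=
  if n is m.+1 then f n * charfun_prod m x else 1.

Lemma charfun_prodS n x :
  charfun_prod n.+1 x = charfun_prod n x * (1 + (f n.+1 - 1) * (p n.+1 x)%:C).
Proof. by rewrite /charfun_prod big_nat_recr. Qed.

(** Averaging over the parent of the vertex n.+1 collapses to a product: passing
    from n to n.+1 multiplies the average over the older vertices by 1 - p and adds
    the term p f_{n+1} times that same average, with p = p_{n+1}(n+1). *)
Lemma sum_wprob_cond_charfun n x :
  \sum_(i < n.+1) (wprob w n i x)%:C * cond_charfun i x = charfun_prod n x.
Proof.
elim: n => [|n IH].
  by rewrite big_ord_recl big_ord0 addr0 wprob00//= mulr1 /charfun_prod big_nil.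
rewrite big_ord_recr/= charfun_prodS.
under eq_bigr do rewrite wprobS// rmorphM -mulrA.
by rewrite -mulr_sumr IH /p rmorphB rmorph1/=; ring.
Qed.

Lemma cbmeas_charfun_prod F n :
  (forall k, (k <= n)%N -> gmeasurable F (w k)) -> cbmeas F (charfun_prod n).
Proof.
move=> mw; rewrite /charfun_prod; under eq_fun do rewrite big_add1 big_mkord.
apply: cbmeas_prod => j _; apply: cbmeasD; first exact: cbmeas_cst.
apply: cbmeasM; first exact: cbmeas_cst.
apply/cbmeas_real/bmeas_wprob => // k kj; apply: mw.
by rewrite (leq_trans kj).
Qed.

Lemma cbmeas_cond_charfun F n :
  (forall k, (k < n)%N -> gmeasurable F (w k)) -> cbmeas F (cond_charfun n).
Proof.
case: n => [|n] mw; first exact: cbmeas_cst.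
by apply: cbmeasM; [exact: cbmeas_cst|exact: cbmeas_charfun_prod].
Qed.

Let past n := rv_events setT w `|` rv_events [set j | (1 <= j)%N] Y
      `|` rv_events [set k | (1 <= k < n)%N] nstar.

Let e n x := expi (t * D n x).
Let y n x := expi (t * Y n x).

Lemma past_measurable n : past n `<=` measurable.
Proof. by move=> A [[|]|]; exact: rv_events_measurable. Qed.

(** The random parent is replaced by a sum over its possible values, the form to
    which the conditional law of the choice applies. *)
Lemma expi_depthE n x : e n.+1 x =
  \sum_(i < n.+1) e i x * y n.+1 x * (\1_(nstar n.+1 @^-1` [set val i]) x)%:C.
Proof.
have lt := @nstar_lt n.+1 x isT.
rewrite (bigD1 (Ordinal lt))//= [X in _ + X]big1 => [|i ne]; last first.
  rewrite indicE memNset ?mulr0//= => ni; move/eqP: ne; apply.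
  exact/val_inj.
by rewrite indicE mem_set// mulr1 addr0 /e DS// mulrDr expiD.
Qed.

Lemma cbmeas_expi_depth n m : (n < m)%N -> cbmeas (past m) (e n).
Proof.
elim/ltn_ind: n => -[_ _|n IH nm].
  rewrite /e; under eq_fun do rewrite D0 mulr0 expi0; exact: cbmeas_cst.
rewrite (funext (expi_depthE n)); apply: cbmeas_sum => i _.
apply: cbmeasM; first apply: cbmeasM.
- by apply: IH => //; exact: ltn_trans nm.
- apply: cbmeas_expi.
  by apply: (gmeasurable_rv (I := [set j | (1 <= j)%N])) => // A ?; left; right.
- apply: cbmeas_indic; apply: sub_sigma_algebra; right.
  by exists n.+1; [rewrite /= nm|exists [set val i]; rewrite ?setTI].
Qed.

(** Conditioning on n.+1's parent i leaves exp(i t D_i) exp(i t Y_{n+1}); its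
    second factor must be independent of the weights and of D_i, although D_i
    depends on earlier choices, whose law is only known given all edge lengths.
    Carrying a product over arbitrary later edges J makes the induction go
    through: the edge n.+1 is simply added to J for the index i, and independence
    is used only at the root, where no choice is left. The multiplier H absorbs
    the probabilities p_n(i). *)
Lemma cexpectation_depth n (J : seq nat) (H : T -> R[i]) :
    uniq J -> (forall j, j \in J -> (n < j)%N) ->
    cbmeas (rv_events setT w) H ->
  cexpectation P (fun x => H x * e n x * \prod_(j <- J) y j x) =
  cexpectation P (fun x => H x * cond_charfun n x) * \prod_(j <- J) f j.
Proof.
have wm := @rv_events_measurable _ _ _ P _ _ setT w.
have Ym := @rv_events_measurable _ _ _ P _ _ [set j | (1 <= j)%N] Y.
elim/ltn_ind: n J H => -[_|n IH] J H uJ Jn mH.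
  (* the guard makes every factor measurable for the edge lengths Y j, j >= 1 *)
  transitivity (cexpectation P
      (fun x => \prod_(j <- J | (1 <= j)%N) y j x * H x)).
    congr cexpectation; apply/funext => x.
    rewrite /e D0 mulr0 expi0 mulr1 mulrC; congr (_ * _).
    rewrite [LHS]big_seq [RHS]big_seq_cond; apply: eq_bigl => j.
    by case: (boolP (j \in J)) => // /Jn ->.
  rewrite (cexpectation_mul_indep Ym wm Yw_indep)//; last first.
    apply: cbmeas_prod => j j1; apply: cbmeas_expi.
    exact: (gmeasurable_rv (I := [set j | (1 <= j)%N])).
  under [in RHS]eq_fun do rewrite mulr1.
  rewrite mulrC; congr (_ * _).
  transitivity (cexpectation P (fun x => \prod_(j <- J) y j x)).
    congr cexpectation; apply/funext => x.
    rewrite [RHS]big_seq [LHS]big_seq_cond; apply: eq_bigl => j.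
    by case: (boolP (j \in J)) => // /Jn ->.
  apply: (cexpectation_prod_indep Y_indep) => // j.
  apply: cbmeas_expi => _ B mB; apply: sub_sigma_algebra.
  by exists B.
set m := n.+1.
have yJ : cbmeas (past m) (fun x => \prod_(j <- m :: J | (1 <= j)%N) y j x).
  apply: cbmeas_prod => j j1; apply: cbmeas_expi.
  by apply: (gmeasurable_rv (I := [set j | (1 <= j)%N])) => // A ?; left; right.
have yJE x : \prod_(j <- m :: J | (1 <= j)%N) y j x = \prod_(j <- m :: J) y j x.
  rewrite [RHS]big_seq [LHS]big_seq_cond; apply: eq_bigl => j; rewrite inE.
  case: eqP => [->//|_] /=.
  by case: (boolP (j \in J)) => // /Jn; rewrite /m; case: j.
have mHp : cbmeas (past m) H.
  by apply: cbmeas_sub mH => A ?; apply: sub_sigma_algebra; left; left.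
have mwp (i : 'I_m) : bmeas (rv_events setT w) (wprob w n i).
  apply: (bmeas_wprob w0 w_gt0) => [k _|]; last by rewrite -ltnS.
  exact: (gmeasurable_rv (I := setT)).
have nm (i : 'I_m) : measurable (nstar m @^-1` [set val i]) by exact: measurable_funPTI.
pose Q i x := H x * e i x * \prod_(j <- m :: J) y j x.
have mQ (i : 'I_m) : cbmeas (past m) (Q i).
  rewrite /Q; under eq_fun do rewrite -yJE.
  by apply: cbmeasM => //; apply: cbmeasM => //; exact: cbmeas_expi_depth.
have mI (i : 'I_m) : bmeas measurable (\1_(nstar m @^-1` [set val i]) : T -> R).
  by apply: bmeas_indic; exact: sub_sigma_algebra.
transitivity (cexpectation P (fun x => \sum_(i < m)
    Q i x * (\1_(nstar m @^-1` [set val i]) x)%:C)).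
  congr cexpectation; apply/funext => x; rewrite expi_depthE.
  rewrite mulr_sumr mulr_suml; apply: eq_bigr => i _.
  by rewrite /Q big_cons; ring.
rewrite cexpectation_sum => [|i]; last first.
  apply: cbmeasM; first exact: cbmeas_full (@past_measurable m) _.
  exact: cbmeas_real.
transitivity (\sum_(i < m) cexpectation P
    (fun x => (H x * (wprob w n i x)%:C) * cond_charfun i x) *
    (f m * \prod_(j <- J) f j)).
  apply: eq_bigr => i _.
  rewrite (cexpectation_mul_cond_exp (@past_measurable m) (mI i) _
    (@nstar_law m i isT (ltn_ord i)) (mQ i)).
    transitivity (cexpectation P (fun x =>
        (H x * (wprob w n i x)%:C) * e i x * \prod_(j <- m :: J) y j x)).
      by congr cexpectation; apply/funext => x; rewrite /Q /=; ring.
    rewrite IH ?big_cons//.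
    - by rewrite /= uJ andbT; apply/negP => /Jn; rewrite ltnn.
    - move=> j; rewrite inE => /predU1P[->|/Jn]; first exact: ltn_ord.
      exact: ltn_trans.
    - by apply: cbmeasM => //; exact: cbmeas_real.
  exact: bmeas_full wm (mwp i).
have mw k : gmeasurable (rv_events setT w) (w k).
  by exact: (gmeasurable_rv (I := setT)).
rewrite -mulr_suml mulrA; congr (_ * _).
rewrite -cexpectation_sum => [|i]; last first.
  apply: (cbmeas_full wm); apply: cbmeasM; last exact: cbmeas_cond_charfun.
  by apply: cbmeasM => //; exact: cbmeas_real.
rewrite -cexpectationZr; last first.
  apply: (cbmeas_full wm); apply: cbmeas_sum => i _.
  apply: cbmeasM; last exact: cbmeas_cond_charfun.
  by apply: cbmeasM => //; exact: cbmeas_real.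
congr cexpectation; apply/funext => x.
rewrite /cond_charfun /m -sum_wprob_cond_charfun.
rewrite mulrCA mulrC; congr (_ * _); rewrite mulr_sumr.
by apply: eq_bigr => i _; rewrite mulrA.
Qed.

Lemma cond_charfun_is_ccond_exp n :
  is_ccond_exp P <<s rv_events [set j | (1 <= j < n)%N] w >>
    (fun x => expi (t * D n x)) (cond_charfun n).
Proof.
have wm I := @rv_events_measurable _ _ _ P _ _ I w.
apply: is_ccond_exp_cexpectation => //.
- by apply: (cbmeas_full (@past_measurable n.+1)); exact: cbmeas_expi_depth.
- apply: cbmeas_cond_charfun => -[_|k kn]; last first.
    exact: (gmeasurable_rv (I := [set j | (1 <= j < n)%N])).
  rewrite (_ : w 0%N = cst 1 :> (T -> R)); first exact: measurable_cst.
  by apply/funext => x; rewrite w0.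
- move=> A FA.
  have wA : cbmeas (rv_events setT w) (fun x => (\1_A x : R)%:C).
    apply: cbmeas_indic; apply: sub_smallest2r FA; last first.
      by move=> B [j _ Bj]; exists j.
    exact: smallest_sigma_algebra.
  have := @cexpectation_depth n [::] _ isT _ wA.
  rewrite big_nil mulr1 => <- //.
  by under [in RHS]eq_fun do rewrite big_nil mulr1.
Qed.

End Tree.

(** * Convergence of the infinite product *)

Section ProductConvergence.
Variable R : realType.

Lemma normc_Re_le (z : R[i]) : (`|complex.Re z|%:C : R[i]) <= `|z|.
Proof.
case: z => a b; rewrite normc_def lecR/= -sqrtr_sqr ler_wsqrtr//.
by rewrite lerDl sqr_ge0.
Qed.

Lemma normc_Im_le (z : R[i]) : (`|complex.Im z|%:C : R[i]) <= `|z|.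
Proof.
case: z => a b; rewrite normc_def lecR/= -sqrtr_sqr ler_wsqrtr//.
by rewrite lerDr sqr_ge0.
Qed.

Lemma cvg_real_complex (u : nat -> R) (l : R) : u @ \oo --> l ->
  ((u n)%:C : R[i]^o) @[n --> \oo] --> (l%:C : R[i]^o).
Proof.
move=> /cvgrPdist_lt ul; apply/cvgrPdist_lt => -[a b].
rewrite ltcE/= => /andP[/eqP-> a0].
apply: filterS (ul a a0) => n /=.
by rewrite -rmorphB/= normc_def/= expr0n/= addr0 sqrtr_sqr ltcR.
Qed.

Lemma cvg_series_le (u v : nat -> R) :
  (forall n, `|u n| <= v n) -> cvgn (series v) -> cvgn (series u).
Proof.
move=> uv cv; apply: normed_cvg; apply: series_le_cvg cv => n;
  [exact: normr_ge0| |exact: uv].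
exact: le_trans (normr_ge0 _) (uv n).
Qed.

(** Completeness is that of R, used for the real and imaginary parts of the
    increments. *)
Lemma cvg_complex_increments (u : nat -> R[i]) (v : nat -> R) :
  (forall n, `|u n.+1 - u n| <= (v n)%:C) -> cvgn (series v) ->
  cvgn (u : nat -> R[i]^o).
Proof.
move=> uv cv.
have cRe : cvgn (fun n => complex.Re (u n)).
  rewrite (funext (eq_sum_telescope (fun n => complex.Re (u n)))).
  apply: is_cvgD; first exact: is_cvg_cst.
  apply: cvg_series_le cv => n; rewrite -lecR (le_trans _ (uv n))//.
  apply: le_trans (normc_Re_le _).
  by rewrite /telescope/=; case: (u n.+1) (u n) => [? ?] [? ?]/=.
have cIm : cvgn (fun n => complex.Im (u n)).
  rewrite (funext (eq_sum_telescope (fun n => complex.Im (u n)))).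
  apply: is_cvgD; first exact: is_cvg_cst.
  apply: cvg_series_le cv => n; rewrite -lecR (le_trans _ (uv n))//.
  apply: le_trans (normc_Im_le _).
  by rewrite /telescope/=; case: (u n.+1) (u n) => [? ?] [? ?]/=.
have -> : u = fun n => (complex.Re (u n))%:C + 'i%C * (complex.Im (u n))%:C.
  by apply/funext => n; rewrite -complexE.
apply/cvg_ex; eexists.
apply: (@cvgD _ R[i]^o); first exact: cvg_real_complex cRe.
apply: (@cvgM R[i]); first exact: cvg_cst.
exact: cvg_real_complex cIm.
Qed.

(** Each factor is a convex combination of 1 and f j, so the partial products
    stay in the unit disc and their increments are at most 2 p j. *)
Lemma is_cvg_convex_prod (f : nat -> R[i]) (p : nat -> R) :
  (forall j, `|f j| <= 1) -> (forall j, 0 <= p j <= 1) ->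
  (\sum_(1 <= j <oo) (p j)%:E < +oo)%E ->
  cvgn (fun n => \prod_(1 <= j < n.+1) (1 + (f j - 1) * (p j)%:C) : R[i]^o).
Proof.
move=> f1 p01 psum; set u := (X in cvgn X).
have pC j : `|(p j)%:C : R[i]| = (p j)%:C.
  by rewrite ger0_norm// ler0c; have /andP[] := p01 j.
have uS n : u n.+1 = u n * (1 + (f n.+1 - 1) * (p n.+1)%:C).
  by rewrite /u big_nat_recr.
have u1 n : `|u n| <= 1.
  elim: n => [|n IH]; first by rewrite /u big_nil normr1.
  rewrite uS normrM -[leRHS]mulr1 ler_pM//.
  have -> : 1 + (f n.+1 - 1) * (p n.+1)%:C =
    (1 - p n.+1)%:C + f n.+1 * (p n.+1)%:C by rewrite rmorphB/=; ring.
  have /andP[p0 p1] := p01 n.+1.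
  rewrite (le_trans (ler_normD _ _))// normrM pC.
  rewrite [X in X + _]ger0_norm ?ler0c ?subr_ge0//.
  rewrite rmorphB/= -lerBrDl subKr.
  by rewrite -[leRHS]mul1r ler_wpM2r ?ler0c.
apply: (@cvg_complex_increments _ (fun n => 2 * p n.+1)) => [n|].
  rewrite uS mulrDr mulr1 addrAC subrr add0r normrM -[leRHS]mul1r ler_pM//.
  rewrite normrM pC rmorphM/= ler_wpM2r ?ler0c//; first by have /andP[] := p01 n.+1.
  by rewrite (le_trans (ler_normB _ _))// normr1
    (_ : 2%:C = 1 + 1) ?lerD// rmorphD.
rewrite (_ : series _ = fun n => 2 * \sum_(1 <= j < n.+1) p j); last first.
  by apply/funext => n; rewrite /series/= -mulr_sumr big_add1.
apply: is_cvgM; first exact: is_cvg_cst.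
have p0 j : 0 <= p j by have /andP[] := p01 j.
apply: nondecreasing_is_cvgn.
  by apply/nondecreasing_seqP => n; rewrite [leRHS]big_nat_recr//= lerDl.
exists (fine (\sum_(1 <= j <oo) (p j)%:E)%E) => _ [n _ <-].
have fs : (\sum_(1 <= j <oo) (p j)%:E)%E \is a fin_num.
  by rewrite ge0_fin_numE//; apply: nneseries_ge0 => j _ _; rewrite lee_fin.
rewrite -lee_fin fineK// -sumEFin; apply: nneseries_lim_ge => j _ _.
by rewrite lee_fin.
Qed.

End ProductConvergence.

Section CharfunBound.
Context d (T : measurableType d) (R : realType) (P : probability T R).

(** The variance is nonnegative. *)
Lemma sqr_Rintegral_le (h : T -> R) : bmeas measurable h ->
  (\int[P]_x h x) ^+ 2 <= \int[P]_x (h x ^+ 2).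
Proof.
move=> mh; set m := Rintegral _ _ _.
have mc r : bmeas measurable (fun x => r * h x).
  by apply: bmeasM => //; exact: bmeas_cst.
have mh2 : bmeas measurable (fun x => h x ^+ 2) by exact: bmeasM.
have : 0 <= \int[P]_x (h x ^+ 2 + (- (2 * m) * h x + m ^+ 2)).
  apply: Rintegral_ge0 => x _.
  by rewrite (_ : _ + _ = (h x - m) ^+ 2) ?sqr_ge0//; ring.
rewrite RintegralD//; last 2 first.
- exact: bmeas_integrable.
- by apply: bmeas_integrable => //; apply: bmeasD => //; exact: bmeas_cst.
rewrite RintegralD//; last 2 first.
- exact: bmeas_integrable.
- by apply: bmeas_integrable => //; exact: bmeas_cst.
rewrite RintegralZl//; last exact: bmeas_integrable.
rewrite Rintegral_cst//= probability_setT mulr1 -/m.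
by rewrite -subr_ge0; congr (0 <= _); ring.
Qed.

(** Bound the squares of the two parts by the expectations of cos^2 and sin^2. *)
Lemma norm_charfun_le1 (X : {RV P >-> R}) t : `|charfun P X t| <= 1.
Proof.
have [mc ms] : cbmeas measurable (fun x => expi (t * X x)).
  by apply: cbmeas_expi => _ B mB; apply: sub_sigma_algebra; exact: measurable_funP.
rewrite /charfun cexpectationE normc_def/= -(rmorph1 (real_complex R)) lecR.
rewrite -sqrtr1 ler_wsqrtr//.
rewrite (le_trans (lerD (sqr_Rintegral_le mc) (sqr_Rintegral_le ms)))//=.
rewrite -RintegralD//; [|by apply: bmeas_integrable => //; exact: bmeasM..].
under eq_Rintegral do rewrite cos2Dsin2.
by rewrite Rintegral_cst//= probability_setT mulr1.
Qed.

End CharfunBound.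

(** * The limit theorem *)

Theorem theorem1 (d : measure_display) (T : measurableType d) (R : realType)
    (P : probability T R)
    (w Y : nat -> {RV P >-> R})
    (nstar : nat -> {RV P >-> nat})
    (D : nat -> T -> R)
    (phi : nat -> R -> T -> R[i])
    (mu : probability (measurableTypeR R) R) (f : R -> R[i])
    (w0 : forall x, w 0%N x = 1)
    (w_gt0 : forall j x, (1 <= j)%N -> 0 < w j x)
    (Y_ge0 : forall j x, (1 <= j)%N -> 0 <= Y j x)
    (Y_indep : mutually_independent [set j | (1 <= j)%N] Y)
    (Yw_indep : independent_systems P
       <<s rv_events [set j | (1 <= j)%N] Y >> <<s rv_events setT w >>)
    (nstar_lt : forall n x, (1 <= n)%N -> (nstar n x < n)%N)
    (nstar_law : attachment_law w Y nstar)
    (D0 : forall x, D 0%N x = 0)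
    (DS : forall n x, (1 <= n)%N -> D n x = D (nstar n x) x + Y n x)
    (phiE : forall n t, (1 <= n)%N ->
       is_ccond_exp P <<s rv_events [set j | (1 <= j < n)%N] w >>
         (fun x => expi (t * D n x)) (phi n t))
    (w_sum : {ae P, forall x,
       (\sum_(1 <= j <oo) (wprob w j j x)%:E < +oo)%E})
    (fE : forall t, f t = charfun mu (fun y => y) t)
    (Y_cvg : forall t, (charfun P (Y n) t : R[i]^o) @[n --> \oo] --> (f t : R[i]^o)) :
  forall t, {ae P, forall x,
    let partial_prod (n : nat) : R[i]^o :=
      \prod_(1 <= j < n.+1)
         (1 + (charfun P (Y j) t - 1) * (wprob w j j x)%:C) in
    cvgn partial_prod /\
    (phi n t x : R[i]^o) @[n --> \oo] --> (f t * limn partial_prod : R[i]^o)}.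
Proof.
move=> t.
have wm I := @rv_events_measurable _ _ _ P _ _ I w.
have phi_eq : {ae P, forall x, forall n,
    phi n.+1 t x = cond_charfun w Y t n.+1 x}.
  apply: ae_foralln => n; apply: (is_ccond_exp_ae_unique (wm _)).
    exact: (phiE n.+1 t isT).
  exact: (cond_charfun_is_ccond_exp t w0 w_gt0 Y_indep Yw_indep
    nstar_lt nstar_law D0 DS).
apply: filterS2 phi_eq w_sum => x phix px.
set partial_prod : nat -> R[i]^o := (X in cvgn X).
have cpp : cvgn partial_prod.
  apply: is_cvg_convex_prod px => j; first exact: norm_charfun_le1.
  by rewrite wprob_ge0// wprob_le1.
split; first exact: cpp.
rewrite -cvg_shiftS.
rewrite (_ : (fun n => phi n.+1 t x : R[i]^o) =
  (fun n => charfun P (Y n.+1) t * partial_prod n)); last first.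
  by apply/funext => n; rewrite phix.
apply: (@cvgM R[i]); last exact: cpp.
by have := Y_cvg t; rewrite -cvg_shiftS.
Qed.
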